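(* Let $n\ge2$. The ideal of $T_{2,n}$ in $\mathbb{C}[z_I: I\subseteq[n],|I|\ge2]$, and hence also the ideal $\mathcal{I}(V)$ of $V={\rm Sec}((\mathbb{P}^1)^{\times n})\cap\{x_\emptyset=1\}$ expressed in secant cumulant coordinates $z_I$ (an ideal of $\mathbb{C}[z_I:\emptyset\ne I\subseteq[n]]$), is generated by all binomials $$z_{I}z_{J\cup\{j\}}-z_{J}z_{I\cup\{j\}},\qquad I,J\subseteq[n],\ |I|,|J|>1,\ j\in[n]\setminus(I\cup J),$$ together with all binomials $$z_{\{i,j\}}z_{\{k,l\}}-z_{\{i,l\}}z_{\{j,k\}},\qquad i,j,k,l\in[n]\text{ all distinct}.$$
   Context: The ground field is $\mathbb{C}$ and $[n]=\{1,\dots,n\}$. Toric variety: $T_{2,n}$ is the Zariski closure, in the affine space with coordinates $z_I$ ($I\subseteq[n]$, $|I|\ge2$), of the image of $(\mathbb{C}^* )^{n+1}\ni(t_0,\dots,t_n)\mapsto(z_I=t_0\prod_{i\in I}t_i)$. Secant variety: $(\mathbb{P}^1)^{\times n}$ is Segre-embedded in $\mathbb{P}^{2^n-1}$ with coordinates $x_I$, $I\subseteq[n]$, by $x_I=\prod_{i\in I}a_i^1\prod_{i\notin I}a_i^2$; ${\rm Sec}$ denotes the Zariski closure of the union of lines joining pairs of distinct points. $V$ is its intersection with the affine chart $x_\emptyset=1$. Secant cumulants: on $x_\emptyset=1$ put $y_\emptyset=1$, $y_{\{i\}}=x_{\{i\}}$ and $y_I=\sum_{A\subseteq I}(-1)^{|I\setminus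 A|}x_A\prod_{i\in I\setminus A}x_{\{i\}}$ for $|I|\ge2$; then $z_\emptyset=1$, $z_{\{i\}}=y_{\{i\}}$ and $z_I=\sum_{\pi}(-1)^{|\pi|-1}\prod_{B\in\pi}y_B$ for $|I|\ge2$, where $\pi$ runs over the interval set partitions of $I$ without singleton blocks, $|\pi|$ is the number of blocks, and an interval set partition of $I$ is a partition into blocks each consisting of consecutive elements of $I$ in the order induced from $1<2<\dots<n$. This is a triangular polynomial change of coordinates, so $\mathbb{C}[x_I:I\ne\emptyset]=\mathbb{C}[z_I:I\ne\emptyset]$. *)

(* Defs.v *)
From HB Require Import structures.
From mathcomp Require Import all_boot all_order all_algebra.
From mathcomp Require Import mpoly.

Set Implicit Arguments.
Unset Strict Implicit.
Unset Printing Implicit Defensive.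

Import GRing.Theory.
Local Open Scope ring_scope.

Section AlgebraicSets.
Variables (K : fieldType) (N : nat).

Definition vanishing_ideal (X : 'rV[K]_N -> Prop) (f : {mpoly K[N]}) : Prop :=
  forall x, X x -> f.@[x 0] = 0.

Definition zariski_closure (X : 'rV[K]_N -> Prop) (x : 'rV[K]_N) : Prop :=
  forall f, vanishing_ideal X f -> f.@[x 0] = 0.

(* In the rest of this section, a subset of a projective space is represented
   by the set of all the nonzero vectors of homogeneous coordinates of its
   points. *)
Definition proj_closure (X : 'rV[K]_N -> Prop) (x : 'rV[K]_N) : Prop :=
  x != 0 /\
  forall (d : nat) (f : {mpoly K[N]}),
    f \is d.-homog -> vanishing_ideal X f -> f.@[x 0] = 0.

Definition same_proj_point (v w : 'rV[K]_N) : Prop :=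
  exists2 c : K, c != 0 & w = c *: v.

Definition proj_line (v w u : 'rV[K]_N) : Prop :=
  u != 0 /\ exists a b : K, u = a *: v + b *: w.

Definition secant_lines (X : 'rV[K]_N -> Prop) (u : 'rV[K]_N) : Prop :=
  exists v w, [/\ X v, X w, ~ same_proj_point v w & proj_line v w u].

Definition proj_secant (X : 'rV[K]_N -> Prop) : 'rV[K]_N -> Prop :=
  proj_closure (secant_lines X).

End AlgebraicSets.

Definition ideal_span (A : comNzRingType) (G : A -> Prop) (f : A) : Prop :=
  exists s : seq (A * A),
    (forall p, p \in s -> G p.2) /\ f = \sum_(p <- s) p.1 * p.2.

(* The subsets of [n] with at least m elements, where [n] is 'I_n, i.e., it is
   shifted to start at 0. They index the coordinates z_I of the toric variety for
   m = 2, the affine coordinates x_I and z_I for m = 1, and the homogeneous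
   coordinates x_I for m = 0. *)
Definition idx (n m : nat) : finType := {I : {set 'I_n} | (m <= #|I|)%N}.

Definition idx_set (n m : nat) (k : 'I_#|idx n m|) : {set 'I_n} :=
  val (enum_val k).

(* A set I with fewer than m elements is not an index and gets the value 1; for
   m = 1 this is the convention x_set0 = 1 and z_set0 = 1. *)
Definition coord (K : fieldType) (n m : nat) (x : 'rV[K]_#|idx n m|)
    (I : {set 'I_n}) : K :=
  if insub I is Some J then x 0 (enum_rank (J : idx n m)) else 1.

Definition var (K : fieldType) (n m : nat) (I : {set 'I_n}) :
    {mpoly K[#|idx n m|]} :=
  if insub I is Some J then 'X_(enum_rank (J : idx n m)) else 1.

Definition toric_param (K : fieldType) (n : nat) (z : 'rV[K]_#|idx n 2|) :
    Prop :=
  exists (t0 : K) (t : 'I_n -> K),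
    [/\ t0 != 0, forall i, t i != 0
      & z = \row_k (t0 * \prod_(i in idx_set k) t i)].

Definition toric (K : fieldType) (n : nat) : 'rV[K]_#|idx n 2| -> Prop :=
  zariski_closure (@toric_param K n).

Definition segre_map (K : fieldType) (n : nat) (a : 'I_n -> K * K) :
    'rV[K]_#|idx n 0| :=
  \row_k ((\prod_(i in idx_set k) (a i).1)
          * \prod_(i in ~: idx_set k) (a i).2).

Definition segre (K : fieldType) (n : nat) (x : 'rV[K]_#|idx n 0|) : Prop :=
  exists a : 'I_n -> K * K,
    (forall i, a i != 0) /\ same_proj_point (segre_map a) x.

Definition secant_chart (K : fieldType) (n : nat) (x : 'rV[K]_#|idx n 1|) :
    Prop :=
  proj_secant (@segre K n) (\row_k coord x (idx_set k)).

(* The order on 'I_n is that of the underlying natural numbers. *)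
Definition interval_partition (n : nat) (P : {set {set 'I_n}})
    (I : {set 'I_n}) : bool :=
  partition P I &&
  [forall B in P, forall a in B, forall b in B, forall c in I,
     (a <= c <= b)%N ==> (c \in B)].

Definition no_singleton (n : nat) (P : {set {set 'I_n}}) : bool :=
  [forall B in P, #|B| != 1%N].

Section SecantCumulants.
Variables (K : fieldType) (n : nat).

Local Notation x := (@var K n 1).

Definition ycum (I : {set 'I_n}) : {mpoly K[#|idx n 1|]} :=
  if (2 <= #|I|)%N then
    \sum_(A : {set 'I_n} | A \subset I)
      (-1) ^+ #|I :\: A| * x A * \prod_(i in I :\: A) x [set i]
  else x I.

Definition zcum (I : {set 'I_n}) : {mpoly K[#|idx n 1|]} :=
  if (2 <= #|I|)%N then
    \sum_(P : {set {set 'I_n}} | interval_partition P I && no_singleton P)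
      (-1) ^+ #|P|.-1 * \prod_(B in P) ycum B
  else ycum I.

(* The isomorphism from the polynomial ring in the z_I to the one in the x_I
   that replaces each z_I by its expression in the x_I. *)
Definition cumulant_subst (f : {mpoly K[#|idx n 1|]}) :
    {mpoly K[#|idx n 1|]} :=
  f \mPo [tuple zcum (idx_set k) | k < #|idx n 1|].

(* The ideal of secant_chart in the ring in the x_I, transported to the
   polynomial ring in the z_I. *)
Definition secant_ideal_cum (f : {mpoly K[#|idx n 1|]}) : Prop :=
  vanishing_ideal (@secant_chart K n) (cumulant_subst f).

End SecantCumulants.

Definition binomials (n : nat) (A : comNzRingType) (z : {set 'I_n} -> A)
    (g : A) : Prop :=
  (exists (I J : {set 'I_n}) (j : 'I_n),
     [/\ (1 < #|I|)%N, (1 < #|J|)%N, j \notin I :|: J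
       & g = z I * z (j |: J) - z J * z (j |: I)])
  \/
  (exists i j k l : 'I_n,
     uniq [:: i; j; k; l]
     /\ g = z [set i; j] * z [set k; l] - z [set i; l] * z [set j; k]).

(* Main.v *)
Require Import Defs.
From mathcomp Require Import all_boot all_order all_algebra.
From mathcomp Require Import mpoly reals complex.
From mathcomp Require Import zify ring.

(* Toric part: a polynomial vanishing on the parametrized points is, modulo the
   differences of monomials of equal multidegree, zero. A monomial in the [z_I]
   is a multiset of sets of size at least 2, and two multisets with the same
   number of sets and the same element multiplicities are connected by the moves
   of the two families of binomials: the first family moves an element from a
   set of size at least 3 to another set; once no such move brings the multisets
   closer, all the sets that differ are edges, and graphs with the same degrees
   are connected by edge swaps.

   Secant part: a general point of the secant variety has [x_I = a * \prod_I p i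
   + b * \prod_I q i] with [a + b = 1]. Then [y_I] is [\prod_I (p i - q i)] times
   the [#|I|]-th central moment of a Bernoulli variable, the sum over interval
   partitions inverts the generating series of these moments, and
   [z_I = a b (b - a) ^ (#|I| - 2) \prod_I (p i - q i)], which is a general point
   of the toric variety, while the [z_[set i]] remain free. *)

Set Implicit Arguments.
Unset Strict Implicit.
Unset Printing Implicit Defensive.

Import Order.TTheory GRing.Theory Num.Theory.
Local Open Scope ring_scope.

(** * Connecting multisets of sets by the binomial moves *)

Section Congruence.
Variables (A : comNzRingType) (G : A -> Prop).

Lemma ideal_span0 : ideal_span G 0.
Proof. by exists [::]; split=> //; rewrite big_nil. Qed.

Lemma ideal_spanD f g : ideal_span G f -> ideal_span G g -> ideal_span G (f + g).
Proof.
move=> [s [sG ->]] [t [tG ->]]; exists (s ++ t); rewrite big_cat; split=> // p.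
by rewrite mem_cat => /orP[/sG|/tG].
Qed.

Lemma ideal_spanM c f : ideal_span G f -> ideal_span G (c * f).
Proof.
move=> [s [sG ->]]; exists [seq (c * p.1, p.2) | p <- s]; split.
  by move=> _ /mapP[p /sG ? ->].
by rewrite big_map mulr_sumr; apply: eq_bigr => p _; rewrite mulrA.
Qed.

Lemma ideal_span_gen f : G f -> ideal_span G f.
Proof.
move=> Gf; exists [:: (1, f)]; split; last by rewrite big_seq1 mul1r.
by move=> p; rewrite inE => /eqP->.
Qed.

Lemma ideal_span_sum (I : eqType) (r : seq I) (F : I -> A) :
  (forall i, i \in r -> ideal_span G (F i)) -> ideal_span G (\sum_(i <- r) F i).
Proof.
move=> GF; rewrite big_seq.
by apply: big_ind => //; [apply: ideal_span0 | apply: ideal_spanD].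
Qed.

Definition congr_mod (a b : A) : Prop := ideal_span G (a - b).

Lemma congr_mod_refl a : congr_mod a a.
Proof. by rewrite /congr_mod subrr; apply: ideal_span0. Qed.

Lemma congr_mod_sym a b : congr_mod a b -> congr_mod b a.
Proof.
by move=> /(ideal_spanM (-1)); rewrite /congr_mod mulN1r opprB.
Qed.

Lemma congr_mod_trans b a c : congr_mod a b -> congr_mod b c -> congr_mod a c.
Proof.
move=> ab /(ideal_spanD ab); rewrite /congr_mod.
by have -> : a - b + (b - c) = a - c by ring.
Qed.

Lemma congr_modM c a b : congr_mod a b -> congr_mod (c * a) (c * b).
Proof. by move=> /(ideal_spanM c); rewrite mulrBr. Qed.

End Congruence.

Lemma exists_count_lt (T : eqType) (p q : pred T) (s : seq T) :
  (count p s < count q s)%N -> exists x, [/\ x \in s, q x & ~~ p x].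
Proof.
move=> lt_pq; have /hasP[x xs /andP[qx px]] : has (predI q (predC p)) s.
  apply: contraTT lt_pq => /hasPn qp; rewrite -leqNgt.
  elim: s qp => //= x s IHs qp; apply: leq_add; last first.
    by apply: IHs => y ys; apply: qp; rewrite inE ys orbT.
  by have := qp x (mem_head _ _); rewrite /=; case: (q x); case: (p x).
by exists x.
Qed.

Section Deformation.
Variables (A : comNzRingType) (n : nat) (z : {set 'I_n} -> A).
Implicit Types (s t : seq {set 'I_n}) (i j k l : 'I_n) (I J : {set 'I_n}).

(** With a list of sets read as a monomial in the [z_I], this is equality of the exponents of [t0]
    (the size) and of each [t_i] (the count) under the toric parametrization. *)
Definition same_degree s t : Prop :=
  size s = size t /\
  forall i, count (fun I => i \in I) s = count (fun I => i \in I) t.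

Lemma same_degree_sym s t : same_degree s t -> same_degree t s.
Proof. by move=> [sz c]; split=> [|i]; rewrite ?sz ?c. Qed.

Lemma same_degree_trans t s u :
  same_degree s t -> same_degree t u -> same_degree s u.
Proof. by move=> [sz1 c1] [sz2 c2]; split=> [|i]; rewrite ?sz1 ?c1. Qed.

(** The degrees are carried along with the congruence, so that they still agree after a chain of
    moves and cancellations. *)
Definition deform s t : Prop :=
  same_degree s t /\
  congr_mod (binomials z) (\prod_(I <- s) z I) (\prod_(I <- t) z I).

Lemma deform_trans t s u : deform s t -> deform t u -> deform s u.
Proof.
move=> [d1 z1] [d2 z2]; split; first exact: same_degree_trans d2.
exact: congr_mod_trans z2.
Qed.

Lemma deform_sym s t : deform s t -> deform t s.
Proof. by move=> [/same_degree_sym? /congr_mod_sym]; split. Qed.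

Lemma deform_perm s t : perm_eq s t -> deform s t.
Proof.
move=> st; split; last by rewrite (perm_big _ st); apply: congr_mod_refl.
by split=> [|i]; [apply: perm_size | move/permP: st].
Qed.

Lemma deform_cons I s t : deform s t -> deform (I :: s) (I :: t).
Proof.
move=> [[sz c] zst]; split; first by split=> [|i] /=; rewrite ?sz ?c.
by rewrite !big_cons; apply: congr_modM.
Qed.

Lemma deform_rem I s : I \in s -> deform s (I :: rem I s).
Proof. by move=> Is; apply/deform_perm/perm_to_rem. Qed.

Lemma deform_consC I J s : deform (I :: J :: s) (J :: I :: s).
Proof. by apply: deform_perm; rewrite (perm_catCA [:: I] [:: J] s). Qed.

Lemma deform_cons2C I J K s : deform [:: I, J, K & s] [:: K, I, J & s].
Proof. by apply: deform_perm; rewrite (perm_catCA [:: I; J] [:: K] s). Qed.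

Lemma deform_shift I J j s : (1 < #|I|)%N -> (1 < #|J|)%N -> j \notin I :|: J ->
  deform ((j |: I) :: J :: s) (I :: (j |: J) :: s).
Proof.
move=> I1 J1 jIJ; split.
  split=> //= i; rewrite !inE; have [->|] := eqVneq i j => //=.
  by move: jIJ; rewrite inE negb_or => /andP[/negPf-> /negPf->].
rewrite !big_cons !mulrA -![_ * \prod_(_ <- _) _]mulrC; apply: congr_modM.
apply: congr_mod_sym; apply: ideal_span_gen; left; exists I, J, j.
by split=> //; rewrite [z J * _]mulrC.
Qed.

Lemma deform_swap i j k l s : uniq [:: i; j; k; l] ->
  deform ([set i; j] :: [set k; l] :: s) ([set i; l] :: [set j; k] :: s).
Proof.
move=> ijkl; split.
  split=> //= m; rewrite !inE !addnA; congr (_ + _)%N.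
  move: ijkl; rewrite /= !inE !negb_or.
  case/and4P=> /and3P[ij ik il] /andP[jk jl] kl _.
  have [->|_] := eqVneq m i.
    by rewrite (negPf ij) (negPf ik) (negPf il).
  have [->|_] := eqVneq m j; first by rewrite (negPf jk) (negPf jl).
  by have [->|_] := eqVneq m k; [rewrite (negPf kl)|case: eqP].
rewrite !big_cons !mulrA -![_ * \prod_(_ <- _) _]mulrC; apply: congr_modM.
by apply: ideal_span_gen; right; exists i, j, k, l.
Qed.

Lemma pair_set i I : #|I| = 2%N -> i \in I -> exists2 j, j != i & I = [set i; j].
Proof.
move=> /eqP/cards2P[a [b [ab ->]]]; rewrite !inE => /orP[]/eqP->.
  by exists b; rewrite 1?eq_sym.
by exists a => //; rewrite setUC.
Qed.

(** * Multigraphs with equal degrees *)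

Definition graph s := forall I, I \in s -> #|I| = 2%N.

Lemma graph_cons I s : graph (I :: s) <-> #|I| = 2%N /\ graph s.
Proof.
split=> [gs|[I2 gs] J]; last by rewrite inE => /orP[/eqP->|/gs].
by split=> [|J Js]; apply: gs; rewrite inE ?Js ?orbT ?eqxx.
Qed.

Lemma graph_rem I s : graph s -> graph (rem I s).
Proof. by move=> gs J /mem_rem/gs. Qed.

Lemma graph_pair i j s : i != j -> graph s -> graph ([set i; j] :: s).
Proof. by move=> ij gs; apply/graph_cons; rewrite cards2 ij. Qed.

(* Joins [a] and [b] by swapping an edge [ac] with an edge [bd]. If every choice
   has [c = d], an edge avoiding [c] is first used to change [ac] into [ae]; it
   exists since [c] has the same degree in [s] and in [t]. *)
Lemma graph_extract a b s t : a != b -> graph s -> graph t ->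
  same_degree s ([set a; b] :: t) ->
  exists2 s', graph s' & deform s ([set a; b] :: s').
Proof.
move=> ab gs gt [sz deg].
have mem_deg i : i \in [set a; b] -> exists2 I, I \in s & i \in I.
  move=> iab; apply/hasP; rewrite has_count deg /= iab //.
have [abs|abs] := boolP ([set a; b] \in s).
  by exists (rem [set a; b] s); [apply: graph_rem | apply: deform_rem].
have [I Is aI] := mem_deg a (set21 _ _).
have [c ca defI] := pair_set (gs _ Is) aI.
have cb : c != b by apply: contraNneq abs => <-; rewrite -defI.
have [J Js bJ] := mem_deg b (set22 _ _).
have [d db defJ] := pair_set (gs _ Js) bJ.
have da : d != a by apply: contraNneq abs => <-; rewrite setUC -defJ.
pose s1 := rem J (rem I s).
have gs1 : graph s1 by do 2!apply: graph_rem.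
have ds1 : deform s ([set a; c] :: [set b; d] :: s1).
  rewrite -defI -defJ; apply: deform_trans (deform_rem Is) _.
  apply/deform_cons/deform_rem/rem_mem => //; apply: contraTneq bJ => ->.
  by rewrite defI !inE negb_or eq_sym ab eq_sym.
have [dc|dc] := eqVneq d c; last first.
  exists ([set c; d] :: s1); first by apply: graph_pair; rewrite // eq_sym.
  apply: deform_trans ds1 _; rewrite [[set b; d]]setUC.
  by apply: deform_swap; rewrite /= !inE !negb_or ab ![a == _]eq_sym ca da cb db
    eq_sym dc.
(* If every edge of [s1] contained [c], then [c] would have degree [size s]; but its degree is that
   in [[set a; b] :: t], whose first edge avoids [c]. *)
subst d; have [E [Es1 _ cE]] : exists E, [/\ E \in s1, predT E & c \notin E].
  apply: exists_count_lt; rewrite count_predT.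
  have [[sz1 /(_ c) deg1] _] := ds1; have := count_size (fun I : {set 'I_n} => c \in I) t.
  clear -sz sz1 deg1 ca cb deg; move: sz sz1 deg1.
  by rewrite deg /= !inE eqxx (negPf ca) (negPf cb) !orbT /=; lia.
pose s2 := rem E s1.
have gs2 : graph s2 by apply: graph_rem.
have E2 : #|E| = 2%N by apply: gs1.
have abE : E != [set a; b].
  apply: contraNneq abs => <-; exact: mem_rem (mem_rem Es1).
have {}ds1 : deform s ([set a; c] :: [set b; c] :: E :: s2).
  by apply: deform_trans ds1 _; do 2!apply: deform_cons; apply: deform_rem.
(* For [E = ae], swapping [ae] with [cb] gives [ab] and [ec]. The case [E = be] is symmetric. *)
have [aE|aE] := boolP (a \in E).
  have [e ea defE] := pair_set E2 aE; rewrite {}defE in ds1 abE cE.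
  have eb : e != b by apply: contraNneq abE => ->.
  have ec : e != c by apply: contraNneq cE => ->; rewrite !inE eqxx orbT.
  exists ([set e; c] :: [set a; c] :: s2).
    by do 2!apply: graph_pair => //; rewrite eq_sym.
  apply: deform_trans ds1 _.
  apply: deform_trans (_ : deform _ ([set a; e] :: [set c; b] :: [set a; c] :: s2)) _.
    rewrite [[set c; b]]setUC; apply: deform_trans (deform_cons2C _ _ _ _) _.
    exact/deform_cons/deform_consC.
  by apply: deform_swap; rewrite /= !inE !negb_or ab ec eb cb ![a == _]eq_sym ea ca.
have [bE|bE] := boolP (b \in E).
  have [e eb defE] := pair_set E2 bE; rewrite {}defE in ds1 abE cE aE.
  have ea : e != a by apply: contraNneq aE => ->; rewrite !inE eqxx orbT.
  have ec : e != c by apply: contraNneq cE => ->; rewrite !inE eqxx orbT.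
  exists ([set e; c] :: [set b; c] :: s2).
    by do 2!apply: graph_pair => //; rewrite eq_sym.
  apply: deform_trans ds1 _.
  apply: deform_trans (_ : deform _ ([set b; e] :: [set c; a] :: [set b; c] :: s2)) _.
    by rewrite [[set c; a]]setUC; apply: deform_cons2C.
  rewrite [[set a; b]]setUC; apply: deform_swap.
  by rewrite /= !inE !negb_or ![b == _]eq_sym ab ec ea ca eb cb.
(* Now [E = ef] avoids [a], [b] and [c]: swapping [ac] with [fe] creates [ae], which is then swapped
   with [cb]. *)
have /cards2P[e [f [ef defE]]] : #|E| == 2%N by apply/eqP.
move: cE aE bE; rewrite defE !inE !negb_or.
move=> /andP[ce cf] /andP[ae af] /andP[be bf].
exists ([set e; c] :: [set c; f] :: s2).
  by apply: graph_pair; [rewrite eq_sym | apply: graph_pair].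
apply: deform_trans ds1 _; rewrite defE.
apply: deform_trans (_ : deform _ ([set a; c] :: [set f; e] :: [set c; b] :: s2)) _.
  rewrite [[set f; e]]setUC [[set c; b]]setUC.
  exact/deform_cons/deform_consC.
apply: deform_trans (_ : deform _ ([set a; e] :: [set c; b] :: [set c; f] :: s2)) _.
  apply: deform_trans (deform_swap _ _) _.
    by rewrite /= !inE !negb_or ae af ce cf [a == c]eq_sym ca [f == e]eq_sym ef.
  exact/deform_cons/deform_consC.
apply: deform_swap.
by rewrite /= !inE !negb_or ab ae [a == c]eq_sym ca [e == c]eq_sym ce [e == b]eq_sym
  be cb.
Qed.

Lemma same_degree_cons I s t u :
  deform s (I :: u) -> same_degree s (I :: t) -> same_degree u t.
Proof.
move=> [[sz1 c1] _] [sz2 c2]; split=> [|i]; first by move: sz1; rewrite sz2 => -[].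
by have := c1 i; rewrite c2 => /addnI.
Qed.

(** Induction on [t]: each of its edges is created in [s] and cancelled. *)
Lemma deform_graph s t : graph s -> graph t -> same_degree s t -> deform s t.
Proof.
elim: t s => [|B t IHt] s gs.
  by move=> _ [/size0nil-> _]; apply: deform_perm.
move=> /graph_cons[/eqP/cards2P[a [b [ab ->]]] gt] deg.
have [u gu su] := graph_extract ab gs gt deg.
apply: (deform_trans su); apply/deform_cons/IHt => //.
exact: same_degree_cons su deg.
Qed.

(** * Reduction of paired multisets to graphs *)

Implicit Types (w : seq ({set 'I_n} * {set 'I_n})).

Definition big_pairs w := forall p, p \in w -> (1 < #|p.1|)%N && (1 < #|p.2|)%N.

(** The successor makes the cancellation of a pair of equal sets decrease the measure too. *)
Definition distance w : nat :=
  \sum_(p <- w) (#|p.1 :\: p.2| + #|p.2 :\: p.1|).+1.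

(** Since [j] is in excess on the left of [p] but has equal degrees in both columns, another pair
    has [j] only on its right. Moving [j] to the left set of that pair shrinks the symmetric
    differences of both pairs; [2 < #|p.1|] keeps the reduced set large enough. *)
Lemma shift_closer w p j :
  big_pairs w -> same_degree (unzip1 w) (unzip2 w) ->
  p \in w -> j \in p.1 -> j \notin p.2 -> (2 < #|p.1|)%N ->
  exists w', [/\ (distance w' < distance w)%N, big_pairs w',
    deform (unzip1 w) (unzip1 w') & perm_eq (unzip2 w) (unzip2 w')].
Proof.
case: p => [I J] /= bw [_ /(_ j) deg] pw jI jJ I2.
pose w1 := rem (I, J) w; have pw1 : perm_eq w ((I, J) :: w1) by apply: perm_to_rem.
have [[I' J'] [/= qw1 jJ' jI']] : exists q, [/\ q \in w1, j \in q.2 & j \notin q.1].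
  apply: exists_count_lt; move: deg; rewrite !count_map.
  by rewrite !(permP pw1) /= jI (negPf jJ) add1n add0n => <-.
pose w2 := rem (I', J') w1.
have pw2 : perm_eq w [:: (I, J), (I', J') & w2].
  by apply: perm_trans pw1 _; rewrite perm_cons perm_to_rem.
have /andP[/= I'1 J'1] : (1 < #|(I', J').1|)%N && (1 < #|(I', J').2|)%N.
  by apply/bw/(mem_rem qw1).
have /andP[_ /= J1] := bw _ pw.
have I3 : (1 < #|I :\ j|)%N by move: I2; rewrite (cardsD1 j) jI.
exists [:: (I :\ j, J), (j |: I', J') & w2]; split.
- rewrite /distance (perm_big _ pw2) !big_cons /= !addnA ltn_add2r.
  have -> : I :\ j :\: J = (I :\: J) :\ j by apply/setP => i; rewrite !inE andbCA.
  have -> : J :\: (I :\ j) = J :\: I.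
    apply/setP => i; rewrite !inE negb_and negbK.
    by have [->|//] := eqVneq i j; rewrite (negPf jJ) !andbF.
  have -> : (j |: I') :\: J' = I' :\: J'.
    apply/setP => i; rewrite !inE.
    by have [->|//] := eqVneq i j; rewrite jJ'.
  have -> : J' :\: (j |: I') = (J' :\: I') :\ j.
    by apply/setP => i; rewrite !inE negb_or andbA.
  rewrite [in X in (_ < X)%N](cardsD1 j (I :\: J)) !inE jI jJ /=.
  rewrite [in X in (_ < X)%N](cardsD1 j (J' :\: I')) !inE jI' jJ' /=.
  by rewrite !add1n !(addSn, addnS) leqnSn.
- move=> q; rewrite !inE => /or3P[/eqP->|/eqP->|qw2] /=; first by rewrite I3.
  + by rewrite J'1 andbT (leq_trans I'1) // subset_leq_card // subsetUr.
  + by apply: bw; apply: mem_rem (mem_rem qw2).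
- apply: deform_trans (deform_perm (perm_map fst pw2)) _ => /=.
  rewrite -{1}(setD1K jI); apply: deform_shift => //.
  by rewrite !inE eqxx.
- exact: (perm_map snd pw2).
Qed.

Lemma deform_pairs w : big_pairs w -> same_degree (unzip1 w) (unzip2 w) ->
  deform (unzip1 w) (unzip2 w).
Proof.
have [k] := ubnP (distance w); elim: k w => // k IHk w; rewrite ltnS => wk bw deg.
have [/hasP[[I J] pw /= /eqP eqIJ]|/hasPn neq] := boolP (has (fun p => p.1 == p.2) w).
  subst J; pose w1 := rem (I, I) w.
  have pw1 : perm_eq w ((I, I) :: w1) by apply: perm_to_rem.
  have dw1 := deform_perm (perm_map fst pw1).
  have dw2 := deform_perm (perm_map snd pw1).
  apply: (deform_trans dw1); apply: deform_trans (deform_sym dw2).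
  apply/deform_cons/IHk.
  - move: wk; rewrite /distance (perm_big _ pw1) big_cons /= => wk1.
    by apply: leq_trans wk1; rewrite addSn ltnS leq_addl.
  - by move=> p /mem_rem/bw.
  - apply: (same_degree_cons (deform_perm (perm_map fst pw1))).
    exact: same_degree_trans deg dw2.1.
have [/hasP[p pw /andP[/subsetPn[j jI jJ] I2]]|/hasPn small1] :=
    boolP (has (fun p : {set 'I_n} * {set 'I_n} =>
                  ~~ (p.1 \subset p.2) && (2 < #|p.1|)%N) w).
  have [w' [w'w bw' dw' /deform_perm dw2]] := shift_closer bw deg pw jI jJ I2.
  apply: (deform_trans dw'); apply: deform_trans (deform_sym dw2).
  apply: IHk => //; first exact: leq_trans wk.
  apply: same_degree_trans (same_degree_sym dw'.1) _.
  exact: same_degree_trans deg dw2.1.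
(* The columns are exchanged in order to apply the same move on the right. *)
pose w' := [seq (p.2, p.1) | p <- w].
have w'1 : unzip1 w' = unzip2 w by rewrite /unzip1 -map_comp.
have w'2 : unzip2 w' = unzip1 w by rewrite /unzip2 -map_comp.
have bw' : big_pairs w' by move=> _ /mapP[p /bw pw ->]; rewrite andbC.
have deg' : same_degree (unzip1 w') (unzip2 w').
  by rewrite w'1 w'2; apply: same_degree_sym.
have distw' : distance w' = distance w.
  by rewrite /distance big_map; apply: eq_bigr => p _ /=; rewrite addnC.
have [/hasP[p pw /andP[/subsetPn[j jI jJ] I2]]|/hasPn small2] :=
    boolP (has (fun p : {set 'I_n} * {set 'I_n} =>
                  ~~ (p.1 \subset p.2) && (2 < #|p.1|)%N) w').
  have [w2 [w2w bw2 dw2 /deform_perm dw2']] := shift_closer bw' deg' pw jI jJ I2.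
  apply: deform_sym; rewrite -w'1 -w'2.
  apply: (deform_trans dw2); apply: deform_trans (deform_sym dw2').
  apply: IHk => //; first by rewrite (leq_trans w2w) // distw'.
  apply: same_degree_trans (same_degree_sym dw2.1) _.
  exact: same_degree_trans deg' dw2'.1.
(* No move is left, so a set not contained in its partner has size 2. A set contained in its partner
   has size 2 as well: the partner, being different, is not contained in it and so has size 2. *)
have both2 p : p \in w -> #|p.1| = 2%N /\ #|p.2| = 2%N.
  move=> pw; have /andP[b1 b2] := bw p pw; have := small1 p pw.
  have /= := small2 (p.2, p.1) (map_f _ pw); have := neq p pw.
  rewrite eqEsubset !negb_and !negbK -!leqNgt.
  have := @subset_leq_card _ p.1 p.2; have := @subset_leq_card _ p.2 p.1.
  move: #|p.1| #|p.2| b1 b2 => m1 m2; clear.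
  by case: (p.1 \subset p.2); case: (p.2 \subset p.1) => //= b1 b2 h1 h2 *; split; lia.
by apply: deform_graph => // _ /mapP[p /both2[? ?] ->].
Qed.

Lemma deform_same_degree s t :
  (forall I, I \in s -> (1 < #|I|)%N) -> (forall I, I \in t -> (1 < #|I|)%N) ->
  same_degree s t -> deform s t.
Proof.
move=> bs bt deg; have [sz _] := deg.
rewrite -(unzip1_zip (s := s) (t := t)) ?sz //.
rewrite -[X in deform _ X](unzip2_zip (s := s) (t := t)) ?sz //.
apply: deform_pairs; last by rewrite unzip1_zip ?unzip2_zip ?sz.
move=> [I J] /(nthP (I, J)) [k]; rewrite size_zip sz minnn => kt <-.
by rewrite nth_zip //= bs ?bt // mem_nth ?sz.
Qed.

End Deformation.

(** * Toric ideals *)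

(** Induction on the number of digits: [c ord0] is the remainder modulo [D], and the quotient has
    the other digits. *)
Lemma digits_inj r D (c c' : 'I_r -> nat) :
  (forall j, c j < D)%N -> (forall j, c' j < D)%N ->
  (\sum_j c j * D ^ j = \sum_j c' j * D ^ j)%N -> c =1 c'.
Proof.
elim: r c c' => [|r IHr] c c' cD c'D; first by move=> _ [].
have split0 (d : 'I_r.+1 -> nat) :
    (\sum_j d j * D ^ j = (\sum_(j < r) d (lift ord0 j) * D ^ j) * D + d ord0)%N.
  rewrite big_ord_recl muln1 addnC big_distrl; congr (_ + _)%N.
  by apply: eq_bigr => j _; rewrite /= -mulnA -expnSr.
rewrite !split0 => eq_cc'.
have D0 : (0 < D)%N by apply: leq_ltn_trans (cD ord0).
have eq0 : c ord0 = c' ord0.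
  by have := congr1 (modn^~ D) eq_cc'; rewrite !modnMDl !modn_small.
have eqS : (fun j => c (lift ord0 j)) =1 (fun j => c' (lift ord0 j)).
  apply: IHr => //; apply/eqP; rewrite -(eqn_pmul2r D0); apply/eqP.
  by apply/eqP; rewrite -(eqn_add2r (c ord0)) eq_cc' eq0.
by move=> j; case: (unliftP ord0 j) => [i|] ->; [apply: eqS | apply: eq0].
Qed.

(** The natural numbers below [size p] are distinct in [K] and already too many roots. *)
Lemma poly_eq0_everywhere (K : numDomainType) (p : {poly K}) :
  (forall u, p.[u] = 0) -> p = 0.
Proof.
move=> p0; apply/eqP; apply: contraT => pn0.
have := max_poly_roots pn0 (rs := [seq i%:R | i <- iota 0 (size p)]).
rewrite size_map size_iota ltnn; apply; first by apply/allP => x _; apply/rootP.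
by rewrite map_inj_uniq ?iota_uniq // => i j /eqP; rewrite eqr_nat => /eqP.
Qed.

(* Kronecker substitution: putting [t j = u ^ (D ^ j)] with [D] large turns
   distinct multidegrees into distinct powers of the single variable [u]. *)
Lemma toric_ideal_span (K : numFieldType) (N : nat) (T : finType)
    (e : 'I_N -> T -> nat) (E : seq K) (G : {mpoly K[N]} -> Prop) f :
  (forall t : T -> K, (forall j, t j \notin E) ->
     f.@[fun k => \prod_j t j ^+ e k j] = 0) ->
  (forall m m' : 'X_{1..N},
     (forall j, \sum_k m k * e k j = \sum_k m' k * e k j)%N ->
     congr_mod G 'X_[m] 'X_[m']) ->
  ideal_span G f.
Proof.
move=> f0 congX; pose deg (m : 'X_{1..N}) j := (\sum_k m k * e k j)%N.
(* [D] exceeds every degree occurring in [f], so these degrees are the base [D] digits of [W m]. *)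
pose D := (\sum_(m <- msupp f) \sum_j deg m j).+1.
pose W m := (\sum_j deg m j * D ^ enum_rank j)%N.
have degD m j : m \in msupp f -> (deg m j < D)%N.
  move=> mf; rewrite ltnS (big_rem _ mf) /= (bigD1 j) //= -addnA.
  exact: leq_addr.
have W_inj m m' : m \in msupp f -> m' \in msupp f -> W m = W m' ->
    congr_mod G 'X_[m] 'X_[m'].
  move=> mf m'f; rewrite /W !(reindex_onto (@enum_val T T) enum_rank) => [|? _|? _];
    rewrite ?enum_rankK //.
  under eq_bigl => i do rewrite enum_valK eqxx.
  under eq_bigr => i _ do rewrite enum_valK.
  under [in RHS]eq_bigl => i do rewrite enum_valK eqxx.
  under [in RHS]eq_bigr => i _ do rewrite enum_valK.
  move=> /digits_inj eqdeg; apply: congX => j; rewrite -[j]enum_rankK.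
  by apply: eqdeg => i; apply: degD.
pose P : {poly K} := \sum_(m <- msupp f) f@_m *: 'X^(W m).
have PE u : P.[u] = f.@[fun k => \prod_(j : T) (u ^+ (D ^ enum_rank j)) ^+ e k j].
  rewrite mevalE horner_sum; apply: eq_bigr => m _.
  rewrite hornerZ hornerXn; congr (_ * _).
  under eq_bigr => k _ do rewrite -prodrXl.
  rewrite exchange_big /= -prodrXr; apply: eq_bigr => j _.
  rewrite mulnC exprM -prodrXr; apply: eq_bigr => k _.
  by rewrite [(m k * _)%N]mulnC exprM.
have P0 : P = 0.
  (* [h] vanishes where some [u ^+ (D ^ enum_rank j)] lies in the forbidden list [E]; elsewhere [f0]
     applies, so [P * h] vanishes everywhere. *)
  pose h : {poly K} := \prod_(j : T) \prod_(a <- E) ('X^(D ^ enum_rank j) - a%:P).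
  have hn0 : h != 0.
    apply/prodf_neq0 => j _; rewrite prodf_seq_neq0; apply/allP => a _ /=.
    by rewrite -size_poly_eq0 size_XnsubC ?expn_gt0.
  suff /eqP : P * h = 0 by rewrite mulf_eq0 (negPf hn0) orbF => /eqP.
  apply: poly_eq0_everywhere => u; rewrite hornerM.
  have [hu|hu] := eqVneq h.[u] 0; first by rewrite hu mulr0.
  rewrite PE f0 ?mul0r // => j; apply: contraNN hu => jE.
  rewrite /h horner_prod (bigD1 j) //= horner_prod (big_rem _ jE) /=.
  by rewrite !hornerE subrr !mul0r.
(* One monomial of [f] is chosen for each weight. *)
pose rep w := nth 0%MM (msupp f) (find (fun m => W m == w) (msupp f)).
have repW m : m \in msupp f -> rep (W m) \in msupp f /\ W (rep (W m)) = W m.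
  move=> mf; have hasm : has (fun m' => W m' == W m) (msupp f).
    by apply/hasP; exists m.
  split; first by rewrite mem_nth // -has_find.
  by apply/eqP/(nth_find _ hasm).
(* The subtracted sum is zero: the coefficients of the monomials of weight [w] add up to the
   coefficient of ['X^w] in [P]. *)
have -> : f = \sum_(m <- msupp f) f@_m *: ('X_[m] - 'X_[rep (W m)]).
  rewrite [LHS]mpolyE; under [RHS]eq_bigr => m _ do rewrite scalerBr.
  rewrite sumrB [X in _ - X](_ : _ = 0) ?subr0 //.
  pose B := (\sum_(m <- msupp f) W m).+1.
  have WB m : m \in msupp f -> (W m < B)%N.
    by move=> mf; rewrite ltnS (big_rem _ mf) leq_addr.
  transitivity (\sum_(w < B) P`_w *: 'X_[rep w] : {mpoly K[N]}).
    rewrite big_seq (partition_big (fun m => inord (W m) : 'I_B) xpredT) //=.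
    apply: eq_bigr => w _; rewrite coef_sum scaler_suml big_seq_cond big_mkcondr.
    rewrite [RHS]big_seq; apply: eq_bigr => m mf; rewrite coefZ coefXn.
    rewrite -val_eqE /= inordK ?WB // [_ == W m]eq_sym; case: eqP => [->|_].
      by rewrite mf mulr1.
    by rewrite andbF mulr0 scale0r.
  by rewrite big1 // => w _; rewrite P0 coef0 scale0r.
apply: ideal_span_sum => m mf; rewrite -mul_mpolyC; apply: ideal_spanM.
by have [repf eqW] := repW m mf; apply: W_inj.
Qed.

(** * Coordinates and monomials indexed by subsets *)

Section Coordinates.
Variables (K : fieldType) (n m : nat).
Implicit Types (I : {set 'I_n}) (k : 'I_#|idx n m|).

Lemma var_idx k : var K m (idx_set k) = 'X_k.
Proof. by rewrite /var /idx_set valK enum_valK. Qed.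

Lemma idx_set_inj : injective (@idx_set n m).
Proof. by move=> k l /val_inj/enum_val_inj. Qed.

Lemma idx_set_ge k : (m <= #|idx_set k|)%N.
Proof. exact: (valP (enum_val k)). Qed.

Lemma idx_setP I : (m <= #|I|)%N -> {k : 'I_#|idx n m| | idx_set k = I}.
Proof.
move=> mI; exists (enum_rank (Sub I mI : idx n m)).
by rewrite /idx_set enum_rankK SubK.
Qed.

Lemma coord_idx (x : 'rV[K]_#|idx n m|) k : Defs.coord x (idx_set k) = x 0 k.
Proof. by rewrite /Defs.coord /idx_set valK enum_valK. Qed.

Lemma coord_small (x : 'rV[K]_#|idx n m|) I : (#|I| < m)%N -> Defs.coord x I = 1.
Proof. by move=> Im; rewrite /Defs.coord insubF // leqNgt Im. Qed.

Lemma meval_var (x : 'rV[K]_#|idx n m|) I : (var K m I).@[x 0] = Defs.coord x I.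
Proof. by rewrite /var /Defs.coord; case: insub => [J|]; rewrite ?mevalXU ?meval1. Qed.

Lemma coord_row (c : {set 'I_n} -> K) I : (m <= #|I|)%N ->
  Defs.coord (\row_k c (idx_set (m := m) k)) I = c I.
Proof. by move=> /idx_setP[k <-]; rewrite coord_idx mxE. Qed.

End Coordinates.

Section ToricMonomials.
Variables (n m : nat).

(* Exponents of the parametrization [z_I = t0 * \prod_(i in I) t i] for
   [#|I| >= 2] and [z_[set i] = mu i]: the index [inl tt] stands for [t0],
   [inr (inl i)] for [t i], and [inr (inr i)] for [mu i]. *)
Definition toric_exp (I : {set 'I_n}) (j : unit + ('I_n + 'I_n)) : nat :=
  match j with
  | inl _ => (1 < #|I|)%N
  | inr (inl i) => (1 < #|I|)%N && (i \in I)
  | inr (inr i) => I == [set i]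
  end.

(** The multiset of sets encoded by a monomial, without the sets of size at most 1, on which no move
    acts. *)
Definition large_factors (a : 'X_{1..#|idx n m|}) : seq {set 'I_n} :=
  flatten [seq nseq (a k) (idx_set k) | k <- enum 'I_#|idx n m| & (1 < #|idx_set k|)%N].

Lemma count_large_factors (p : pred {set 'I_n}) a :
  (count p (large_factors a) =
   \sum_k a k * ((1 < #|idx_set k|) && p (idx_set k)))%N.
Proof.
rewrite count_flatten sumnE !big_map big_filter big_enum_cond big_mkcond /=.
by apply: eq_bigr => k _; rewrite count_nseq mulnC; case: (1 < _)%N; rewrite ?muln0.
Qed.

Lemma prod_large_factors (K : fieldType) a :
  \prod_(I <- large_factors a) var K m I =
  \prod_(k | (1 < #|idx_set k|)%N) 'X_k ^+ a k.
Proof.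
rewrite big_flatten big_map big_filter big_enum_cond /=.
apply: eq_bigr => k _; rewrite big_nseq -var_idx.
by elim: (a k) => [|l IHl]; rewrite ?iterS ?IHl ?exprS.
Qed.

Lemma large_factors_large a I : I \in large_factors a -> (1 < #|I|)%N.
Proof.
move=> /flattenP[_ /mapP[k + ->]]; rewrite mem_filter => /andP[k1 _].
by rewrite mem_nseq => /andP[_ /eqP->].
Qed.

(** The exponents [inr (inr i)] force equal powers of the singleton variables; the other factors are
    connected by moves. [0 < m] rules out a variable for the empty set, which [toric_exp] would not
    see. *)
Lemma congr_toric_exp (K : fieldType) (a b : 'X_{1..#|idx n m|}) :
  (0 < m)%N ->
  (forall j, \sum_k a k * toric_exp (idx_set k) j =
             \sum_k b k * toric_exp (idx_set k) j)%N ->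
  congr_mod (binomials (@var K n m)) 'X_[a] 'X_[b].
Proof.
move=> m0 eqab.
have splitX (c : 'X_{1..#|idx n m|}) : 'X_[K, c] =
    \prod_(k | ~~ (1 < #|idx_set k|)%N) 'X_k ^+ c k *
    \prod_(I <- large_factors c) var K m I.
  rewrite prod_large_factors mpolyXE_id mulrC.
  exact: (bigID (fun k => 1 < #|idx_set k|)%N).
rewrite !splitX (eq_bigr (fun k => 'X_k ^+ b k)) => [|k k1].
  apply: congr_modM; apply: (deform_same_degree (@var K n m) _ _ _).2.
  - exact: large_factors_large.
  - exact: large_factors_large.
  split=> [|i]; last by rewrite !count_large_factors; apply: eqab (inr (inl i)).
  rewrite -!(count_predT (large_factors _)) !count_large_factors.
  have := eqab (inl tt); rewrite /toric_exp.
  under eq_bigr do rewrite -[(1 < _)%N]andbT.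
  by under [in RHS]eq_bigr do rewrite -[(1 < _)%N]andbT.
have /cards1P[i Ik] : #|idx_set k| == 1%N.
  by rewrite eqn_leq leqNgt k1 (leq_trans m0) ?idx_set_ge.
have single (c : 'X_{1..#|idx n m|}) :
    (\sum_l c l * toric_exp (idx_set l) (inr (inr i)) = c k)%N.
  rewrite (bigD1 k) //= Ik eqxx muln1 big1 ?addn0 // => l lk.
  by rewrite -Ik (inj_eq (@idx_set_inj n m)) (negPf lk) muln0.
by congr (_ ^+ _); rewrite -single eqab single.
Qed.

End ToricMonomials.

Lemma ideal_span_vanish (K : fieldType) (N : nat) (G : {mpoly K[N]} -> Prop) v f :
  (forall g, G g -> g.@[v] = 0) -> ideal_span G f -> f.@[v] = 0.
Proof.
move=> G0 [s [sG ->]]; rewrite (raddf_sum (meval v)) big_seq big1 // => p /sG/G0 p0.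
by rewrite /= mevalM p0 mulr0.
Qed.

(** This form covers both varieties: [s = 1] gives the toric parametrization and [s = b - a] the
    cumulants of a two-point distribution. *)
Lemma binomials_vanish (K : fieldType) (n m : nat) (v : 'I_#|idx n m| -> K)
    (c s : K) (d : 'I_n -> K) g :
  (forall I : {set 'I_n}, (1 < #|I|)%N ->
     (var K m I).@[v] = c * s ^+ (#|I| - 2) * \prod_(i in I) d i) ->
  binomials (@var K n m) g -> g.@[v] = 0.
Proof.
move=> vE [[I [J [j [I1 J1 jIJ ->]]]]|[i [j [k [l [ijkl ->]]]]]].
  move: jIJ; rewrite inE negb_or => /andP[jI jJ].
  rewrite mevalB !mevalM !vE ?cardsU1 ?jI ?jJ //; try lia.
  rewrite !(big_setU1 _ jI) !(big_setU1 _ jJ) /= !add1n !subSn // !exprS.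
  by ring.
move: ijkl; rewrite /= !inE !negb_or => /and4P[/and3P[ij ik il] /andP[jk jl] kl _].
rewrite mevalB !mevalM !vE ?cards2 ?ij ?kl ?il ?jk //=.
rewrite !big_setU1 ?inE //= !big_set1; ring.
Qed.

Lemma meval_toric_exp (K : fieldType) (n m : nat)
    (t : unit + ('I_n + 'I_n) -> K) (k : 'I_#|idx n m|) :
  (0 < m)%N ->
  \prod_j t j ^+ toric_exp (idx_set k) j =
  if (1 < #|idx_set k|)%N then t (inl tt) * \prod_(i in idx_set k) t (inr (inl i))
  else \prod_(i in idx_set k) t (inr (inr i)).
Proof.
move=> m0; rewrite !big_sumType (big_pred1 tt) => [|[]//] /=.
case: ifPn => k1.
  rewrite expr1 [X in _ * (_ * X)]big1 ?mulr1 => [|i _].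
    by congr (_ * _); rewrite [RHS]big_mkcond; apply: eq_bigr => i _; case: (i \in _).
  by case: eqP k1 => // ->; rewrite cards1.
have /cards1P[i Ik] : #|idx_set k| == 1%N.
  by rewrite eqn_leq leqNgt k1 (leq_trans m0) ?idx_set_ge.
rewrite expr0 mul1r big1 ?mul1r ?Ik ?big_set1 //.
rewrite (bigD1 i) //= eqxx big1 ?mulr1 // => j ji.
by rewrite (inj_eq set1_inj) eq_sym (negPf ji).
Qed.

(** * Secant cumulants of two-point distributions *)

Section IntervalPartitions.
Variables (K : comNzRingType) (n : nat).
Implicit Types (I B : {set 'I_n}) (P : {set {set 'I_n}}) (c : 'I_n).

(** These sets are the candidates for the last block of an interval partition of [I]. *)
Definition upper_part I c : {set 'I_n} := [set x in I | (c <= x)%N].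

(** The sizes of the upper parts are 1 to [#|I|], each once; the induction removes the minimum of
    [I], whose upper part is [I] itself. *)
Lemma sum_upper_part (F : nat -> K) I :
  \sum_(c in I) F #|upper_part I c| = \sum_(1 <= k < #|I|.+1) F k.
Proof.
have [l] := ubnP #|I|; elim: l I => // l IHl I; rewrite ltnS => Il.
have [->|/set0Pn[c0 c0I]] := eqVneq I set0; first by rewrite big_set0 cards0 big_geq.
case: (arg_minnP (fun c => nat_of_ord c) c0I) => {c0 c0I} c cI c_min.
have {}cI : c \in I := cI.
have cardI : #|I| = #|I :\ c|.+1 by rewrite (cardsD1 c) cI.
rewrite (big_setD1 c) //= (_ : upper_part I c = I); last first.
  apply/setP => x; rewrite !inE; case: (boolP (x \in I)) => //= xI.
  exact: c_min.
rewrite [in RHS]cardI big_nat_recr //= -IHl -?cardI //.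
rewrite [RHS]addrC; congr (_ + _).
apply: eq_bigr => x; rewrite !inE => /andP[xc xI].
congr (F #|pred_of_set _|); apply/setP => y; rewrite !inE.
have [->|//] := eqVneq y c; rewrite /= andbC leqNgt ltn_neqAle.
by rewrite eq_sym -val_eqE in xc; rewrite xc c_min.
Qed.

(** The block of the maximum of [I] is the upper part of its own minimum. It is the only such block
    because every nonempty upper part contains the maximum. *)
Lemma upper_part_block P I : interval_partition P I -> I != set0 ->
  exists2 c, c \in I & forall c', (c' \in I) && (upper_part I c' \in P) = (c' == c).
Proof.
move=> /andP[partP /forall_inP intP] /set0Pn[c0 c0I].
case: (arg_maxnP (fun c => nat_of_ord c) c0I) => {c0 c0I} M MI M_max.
have {}MI : M \in I := MI.
have covP := cover_partition partP; have tiP := partition_trivIset partP.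
have MP : M \in cover P by rewrite covP.
have BP := pblock_mem MP; have MB : M \in pblock P M by rewrite mem_pblock.
have BI x : x \in pblock P M -> x \in I.
  by rewrite -covP => xB; apply/bigcupP; exists (pblock P M).
case: (arg_minnP (fun c => nat_of_ord c) MB) => c cB c_min.
have {}cB : c \in pblock P M := cB.
have upc : upper_part I c = pblock P M.
  apply/setP => x; rewrite inE; apply/andP/idP => [[xI cx]|xB]; last first.
    by rewrite BI // c_min.
  have /forall_inP/(_ c cB)/forall_inP/(_ M MB)/forall_inP/(_ x xI) := intP _ BP.
  by move=> /implyP; apply; rewrite cx; apply: M_max.
exists c => [|c']; first exact: BI.
apply/andP/eqP => [[c'I upc'P]|->]; last by rewrite upc BI.
have upc' : upper_part I c' = upper_part I c.
  by rewrite upc -(def_pblock tiP upc'P (x := M)) // inE MI; apply: M_max.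
have: c' \in upper_part I c by rewrite -upc' inE c'I /=.
have: c \in upper_part I c' by rewrite upc' inE BI //=.
by rewrite !inE => /andP[_ le1] /andP[_ le2]; apply/val_inj/eqP; rewrite eqn_leq le1.
Qed.

(** Bijection behind the recursion on the last block, in the form that [reindex_onto] produces; the
    second conjunct says that the block is not already in [P]. *)
Lemma interval_partition_upper P I c : c \in I ->
  interval_partition (upper_part I c |: P) I
      && ((upper_part I c |: P) :\ upper_part I c == P)
    = interval_partition P (I :\: upper_part I c).
Proof.
move=> cI; set B := upper_part I c.
have cB : c \in B by rewrite inE cI /=.
have BI : B \subset I by apply/subsetP => x; rewrite inE => /andP[].
apply/andP/idP =>
  [[/andP[partP /forall_inP intP] /eqP defP]|/andP[partP /forall_inP intP]].
  apply/andP; split; first by rewrite -defP partitionD1 ?setU11.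
  apply/forall_inP => B' B'P; apply/forall_inP => a aB'; apply/forall_inP => b bB'.
  apply/forall_inP => x /setDP[xI _].
  have B'P' : B' \in B |: P by rewrite inE B'P orbT.
  by have /forall_inP/(_ a aB')/forall_inP/(_ b bB')/forall_inP/(_ x xI) := intP _ B'P'.
have notB B' : B' \in P -> B' \subset I :\: B.
  by move=> B'P; rewrite -(cover_partition partP) (bigcup_sup B').
split; last first.
  rewrite setU1K //; apply/negP => /notB/subsetP/(_ c cB).
  by rewrite inE cB.
apply/andP; split.
  rewrite -(setID I B) (setIidPr BI); apply: partitionU1 => //.
    by apply/set0Pn; exists c.
  by rewrite disjoint_sym disjoints_subset subsetDr.
apply/forall_inP => B' /setU1P[->|B'P]; apply/forall_inP => a aB';
  apply/forall_inP => b bB'; apply/forall_inP => x xI; apply/implyP => /andP[ax xb].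
  by move: aB'; rewrite !inE xI => /andP[_ /leq_trans->].
have xD : x \in I :\: B.
  have := subsetP (notB _ B'P) b bB'; rewrite !inE xI !andbT => /andP[+ bI].
  by rewrite bI /= -!ltnNge; apply: leq_ltn_trans.
have /forall_inP/(_ a aB')/forall_inP/(_ b bB')/forall_inP/(_ x xD) := intP _ B'P.
by move/implyP; apply; rewrite ax.
Qed.

Definition interval_sum (w : {set 'I_n} -> K) I : K :=
  \sum_(P | interval_partition P I) \prod_(B in P) w B.

Lemma interval_sum0 w : interval_sum w set0 = 1.
Proof.
rewrite /interval_sum (big_pred1 set0) ?big_set0 // => P.
rewrite /interval_partition partition_set0 /= andb_idr // => /eqP->.
by apply/forall_inP => B; rewrite inE.
Qed.

(* Splits off the last block of the partition, which contains the maximum of [I]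
   and is determined by its minimum [c]. *)
Lemma interval_sum_rec w I : I != set0 ->
  interval_sum w I =
  \sum_(c in I) w (upper_part I c) * interval_sum w (I :\: upper_part I c).
Proof.
move=> In0; rewrite /interval_sum.
transitivity (\sum_(P | interval_partition P I)
    \sum_(c | (c \in I) && (upper_part I c \in P)) \prod_(B in P) w B).
  apply: eq_bigr => P /upper_part_block/(_ In0)[c _ cP].
  by rewrite (big_pred1 c).
rewrite (exchange_big_dep (mem I)) /= => [|P c _ /andP[]//].
apply: eq_bigr => c cI; set B := upper_part I c.
rewrite (reindex_onto (fun P => B |: P) (fun P => P :\ B)) => [|P /andP[_ /andP[_ BP]]];
  last exact: setD1K.
rewrite big_distrr /=; apply: eq_big => [P|P].
  by rewrite cI setU11 !andbT interval_partition_upper.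
move=> /andP[_ /eqP PB]; rewrite big_setU1 //= -PB.
by rewrite !inE eqxx.
Qed.

End IntervalPartitions.

(** * Moments and cumulants of a two-point distribution *)

Section TwoPointCumulants.
Variables (K : fieldType) (n : nat) (a b : K) (p q : 'I_n -> K).
Hypothesis ab1 : a + b = 1.
Implicit Types I : {set 'I_n}.

(* The moments [x_I] of a random vector that is [p] with probability [a] and [q]
   with probability [b]. *)
Definition two_point : 'rV[K]_#|idx n 1| :=
  \row_k (a * \prod_(i in idx_set k) p i + b * \prod_(i in idx_set k) q i).

(* The [m]-th central moment of a Bernoulli variable of parameter [a]. *)
Definition central m : K := a * b ^+ m + b * (- a) ^+ m.

(* The coefficients of the inverse of the power series of the [central m]. *)
Definition central_inv m : K :=
  if m is m'.+1 then if m' is l.+1 then - (a * b * (b - a) ^+ l) else 0 else 1.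

Let bE : b = 1 - a. Proof. by rewrite -ab1; ring. Qed.

Lemma coord_two_point I : Defs.coord two_point I =
  a * \prod_(i in I) p i + b * \prod_(i in I) q i.
Proof.
have [I1|I1] := ltnP 0 #|I|; first by rewrite /two_point (coord_row
    (fun I => a * \prod_(i in I) p i + b * \prod_(i in I) q i)).
rewrite coord_small // [I](_ : _ = set0) ?big_set0 ?mulr1 ?ab1 //.
by apply/eqP; rewrite -cards_eq0 -leqn0.
Qed.

Lemma prodD_subset I (f g : 'I_n -> K) :
  \prod_(i in I) (f i + g i) =
  \sum_(A : {set 'I_n} | A \subset I) (\prod_(i in A) f i) * \prod_(i in I :\: A) g i.
Proof.
pose f' i := if i \in I then f i else 0; pose g' i := if i \in I then g i else 1.
transitivity (\prod_i (f' i + g' i)).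
  rewrite big_mkcond; apply: eq_bigr => i _.
  by rewrite /f' /g'; case: ifP; rewrite ?add0r.
rewrite bigA_distr [RHS]big_mkcond /=; apply: eq_bigr => A _.
case: ifPn => [/subsetP AI|/subsetPn[i iA iI]]; last first.
  by rewrite (bigD1 i) //= iA /f' (negPf iI) mul0r.
rewrite (bigID (mem A)) /=; congr (_ * _).
  by apply: eq_bigr => i iA; rewrite iA /f' AI.
rewrite [LHS]big_mkcond [RHS]big_mkcond; apply: eq_bigr => i _.
by rewrite !inE /g'; case: (i \in A) => //=.
Qed.

(** [ycum] is the expanded expectation of the product of the centred variables, and centring at the
    mean turns [p i] into [b * (p i - q i)] and [q i] into [- a * (p i - q i)]. *)
Lemma meval_ycum I : (1 < #|I|)%N ->
  (ycum K I).@[two_point 0] = central #|I| * \prod_(i in I) (p i - q i).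
Proof.
move=> I1; rewrite /ycum I1 (raddf_sum (meval _)) /=.
pose mu i := a * p i + b * q i.
have E (A : {set 'I_n}) : A \subset I ->
    ((-1) ^+ #|I :\: A| * var K 1 A *
       \prod_(i in I :\: A) var K 1 [set i]).@[two_point 0] =
    a * (\prod_(i in A) p i * \prod_(i in I :\: A) - mu i) +
    b * (\prod_(i in A) q i * \prod_(i in I :\: A) - mu i).
  move=> AI; rewrite !mevalM rmorphXn rmorphN1 meval_var coord_two_point.
  rewrite (rmorph_prod (meval _)) /= [X in _ * X](eq_bigr mu) => [|i _]; last first.
    by rewrite meval_var coord_two_point !big_set1.
  rewrite prodrN; ring.
rewrite (eq_bigr _ E) big_split /= -!mulr_sumr -!prodD_subset.
have -> : \prod_(i in I) (p i - mu i) = b ^+ #|I| * \prod_(i in I) (p i - q i).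
  rewrite -prodr_const -big_split /=; apply: eq_bigr => i _.
  by rewrite /mu bE; ring.
have -> : \prod_(i in I) (q i - mu i) = (- a) ^+ #|I| * \prod_(i in I) (p i - q i).
  rewrite -prodr_const -big_split /=; apply: eq_bigr => i _.
  by rewrite /mu bE; ring.
by rewrite /central; ring.
Qed.

(** [b] and [- a] are the roots of [X^2 - (b - a) X - a b], which gives a two-term recurrence;
    unrolling it gives the convolution. *)
Lemma central_conv l :
  central l.+2 = a * b * \sum_(0 <= k < l.+1) central k * (b - a) ^+ (l - k).
Proof.
have rec m : central m.+2 = (b - a) * central m.+1 + a * b * central m.
  rewrite /central !exprS bE; ring.
elim: l => [|l IHl].
  by rewrite rec big_nat1 /central !expr0 !expr1 bE; ring.
rewrite rec IHl [in RHS]big_nat_recr //= subnn expr0 mulr1 [RHS]mulrDr; congr (_ + _).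
rewrite mulrCA mulr_sumr; congr (_ * _); apply: eq_big_nat => k /andP[_ kl].
by rewrite subSn // exprS; ring.
Qed.

Lemma central_inv_rec m : (0 < m)%N ->
  \sum_(1 <= k < m.+1) - central k * central_inv (m - k) = central_inv m.
Proof.
case: m => // -[|l] _.
  by rewrite big_nat1 subnn /central /= !expr1; ring.
(* The terms with [central_inv 0 = 1] and [central_inv 1 = 0] are split off. By [central_conv] the
   rest cancels except for the summand [k = 0], which is [central_inv l.+2]. *)
rewrite big_nat_recr // big_nat_recr //= subnn subSnn /= mulr1 mulr0 addr0.
rewrite central_conv [X in a * b * X]big_ltn // [central 0]/central.
rewrite !expr0 !mulr1 ab1 mul1r subn0.
rewrite mulrDr opprD addrCA -[RHS]addr0; congr (_ + _).
rewrite mulr_sumr -sumrN -big_split /=; rewrite big1_seq // => k.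
rewrite mem_index_iota => /andP[_ /andP[_ kl]].
by have kl1 := ltnW kl; rewrite !subSn //=; ring.
Qed.

(** The weights depend only on block sizes, so splitting off the last block becomes the recurrence
    [central_inv_rec]. *)
Lemma interval_sum_central I :
  interval_sum (fun B => - central #|B|) I = central_inv #|I|.
Proof.
have [l] := ubnP #|I|; elim: l I => // l IHl I; rewrite ltnS => Il.
have [->|I0] := eqVneq I set0; first by rewrite interval_sum0 cards0.
rewrite interval_sum_rec // -central_inv_rec ?card_gt0 // -sum_upper_part.
apply: eq_bigr => c cI; have upI : upper_part I c \subset I.
  by apply/subsetP => x; rewrite inE => /andP[].
have up0 : (0 < #|upper_part I c|)%N.
  by rewrite card_gt0; apply/set0Pn; exists c; rewrite inE cI /=.
have cardD : #|I :\: upper_part I c| = (#|I| - #|upper_part I c|)%N.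
  by rewrite cardsD (setIidPr upI).
rewrite IHl cardD // (leq_trans _ Il) // ltn_subrL up0.
by rewrite (leq_trans up0) ?subset_leq_card.
Qed.

(** The sign of a partition is absorbed by the weights [- central #|B|], up to one global sign. *)
Lemma meval_zcum I : (1 < #|I|)%N ->
  (zcum K I).@[two_point 0] =
  a * b * (b - a) ^+ (#|I| - 2) * \prod_(i in I) (p i - q i).
Proof.
move=> I1; rewrite /zcum I1 (raddf_sum (meval _)) /=.
transitivity (- interval_sum (fun B => - central #|B|) I * \prod_(i in I) (p i - q i));
  last first.
  by rewrite interval_sum_central; case: #|I| I1 => [|[|m]] //= _;
     rewrite opprK subSS subn1 /=.
rewrite /interval_sum -sumrN mulr_suml big_mkcondr /=; apply: eq_bigr => P.
move=> /andP[partP _]; case: ifPn => [/forall_inP nosing|].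
  rewrite mevalM rmorphXn rmorphN1 (rmorph_prod (meval _)) /=.
  have P0 : (0 < #|P|)%N.
    rewrite card_gt0; apply: contraTneq I1 => P0; move: partP.
    by rewrite P0 => /cover_partition; rewrite /cover big_set0 => <-; rewrite cards0.
  rewrite prodrN -(prednK P0) exprS /= (set_partition_big _ partP) /=.
  rewrite -[X in _ * X]mulr1 mulN1r !mulNr opprK -!mulrA; congr (_ * _).
  rewrite !mulr1 -big_split; apply: eq_bigr => B BP; apply: meval_ycum.
  have /and3P[_ _ P0'] := partP.
  rewrite ltn_neqAle eq_sym nosing //= card_gt0.
  by apply: contraNneq P0' => <-.
(* A singleton block has weight zero, since the first central moment vanishes; so [interval_sum] may
   range over all interval partitions. *)
rewrite /no_singleton negb_forall_in => /exists_inP[B BP /negPn/eqP B1].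
rewrite (bigD1 B) //= B1 /central !expr1.
have -> : - (a * b + b * - a) = 0 by ring.
by rewrite mul0r oppr0 mul0r.
Qed.

Lemma meval_zcum1 i : (zcum K [set i]).@[two_point 0] = a * p i + b * q i.
Proof. by rewrite /zcum /ycum cards1 /= meval_var coord_two_point !big_set1. Qed.

End TwoPointCumulants.

(** * The affine chart of the secant variety *)

Lemma meval_var_fun (K : fieldType) (n m : nat) (X : {set 'I_n} -> K) (I : {set 'I_n}) :
  (m <= #|I|)%N -> (var K m I).@[fun k => X (idx_set k)] = X I.
Proof. by move=> /idx_setP[k <-]; rewrite var_idx mevalXU. Qed.

(** The degree [msize g] exceeds the degree of every monomial of [g], so each term keeps a factor
    [x_set0] and the homogenization vanishes at infinity. *)
Lemma homogenize (K : fieldType) (n : nat) (g : {mpoly K[#|idx n 1|]}) :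
  exists d (G : {mpoly K[#|idx n 0|]}), G \is d.-homog /\
    forall X : {set 'I_n} -> K,
      G.@[fun k => X (idx_set k)] =
      if X set0 == 0 then 0
      else X set0 ^+ d * g.@[fun k => X (idx_set k) / X set0].
Proof.
have var1 (I : {set 'I_n}) : var K 0 I \is 1.-homog.
  by have [k <-] := idx_setP (leq0n #|I|); rewrite var_idx dhomogX /= mdeg1.
exists (msize g), (\sum_(m <- msupp g) g@_m *:
  (var K 0 set0 ^+ (msize g - mdeg m) * \prod_k var K 0 (idx_set k) ^+ m k)).
split.
  rewrite big_seq; apply: rpred_sum => m /msize_mdeg_lt/ltnW mg; apply: dhomogZ.
  rewrite -[X in X.-homog](subnK mg); apply: dhomogM.
    by rewrite -[X in X.-homog]mul1n; apply: dhomogMn.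
  rewrite mdegE; apply: (big_ind2 (fun p d => p \is d.-homog)).
  - exact: dhomog1.
  - by move=> p d q e; apply: dhomogM.
  - by move=> k _; rewrite -[X in X.-homog]mul1n; apply: dhomogMn.
move=> X; rewrite (raddf_sum (meval _)) /=.
have E m : (g@_m *: (var K 0 set0 ^+ (msize g - mdeg m) *
      \prod_k var K 0 (idx_set k) ^+ m k)).@[fun k => X (idx_set k)] =
    g@_m * (X set0 ^+ (msize g - mdeg m) * \prod_k X (idx_set k) ^+ m k).
  rewrite mevalZ mevalM rmorphXn (rmorph_prod (meval _)) /= meval_var_fun //.
  congr (_ * (_ * _)); apply: eq_bigr => k _.
  by rewrite rmorphXn /= meval_var_fun.
rewrite (eq_bigr _ (fun m _ => E m)).
case: eqP => [->|/eqP X0].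
  rewrite big_seq big1 // => m /msize_mdeg_lt mg.
  by rewrite expr0n subn_eq0 leqNgt mg mul0r mulr0.
rewrite mevalE mulr_sumr big_seq [RHS]big_seq; apply: eq_bigr => m /msize_mdeg_lt/ltnW mg.
rewrite [RHS]mulrCA; congr (_ * _).
rewrite -[in RHS](subnK mg) exprD -mulrA; congr (_ * _).
rewrite mdegE -prodrXr -big_split /=; apply: eq_bigr => k _.
by rewrite -exprMn mulrC divfK.
Qed.

Lemma prod_divr_setC (K : fieldType) (n : nat) (f g : 'I_n -> K) (I : {set 'I_n}) :
  (forall i, g i != 0) ->
  \prod_(i in I) f i * \prod_(i in ~: I) g i =
  \prod_i g i * \prod_(i in I) (f i / g i).
Proof.
move=> g0; rewrite (bigID (mem I) xpredT g) /= mulrAC -big_split /=.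
congr (_ * _); apply: eq_big => // i; last by rewrite inE.
by rewrite mulrC divfK.
Qed.

(* A point of a secant line with [a i].2 = 0 for some [i] is not of the form
   [two_point]; it is the limit at [0] of the points of that form obtained by
   adding a variable to every [(a i).2] and [(b i).2]. *)
Lemma secant_vanish (K : numFieldType) (n : nat) (g : {mpoly K[#|idx n 1|]}) :
  (forall (a b : K) (p q : 'I_n -> K), a + b = 1 -> g.@[two_point a b p q 0] = 0) ->
  vanishing_ideal (@secant_chart K n) g.
Proof.
move=> g0 x [_ xcl]; have [d [G [Ghom GE]]] := homogenize g.
have G0 : vanishing_ideal (secant_lines (@segre K n)) G.
  move=> _ [_ [_ [[A [_ [c1 _ ->]]] [B [_ [c2 _ ->]]] _ [_ [a [b ->]]]]]].
  pose lin (C : 'I_n -> K * K) i : {poly K} := 'X + (C i).2%:P.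
  pose U (I : {set 'I_n}) : {poly K} :=
    (a * c1 * \prod_(i in I) (A i).1) *: \prod_(i in ~: I) lin A i +
    (b * c2 * \prod_(i in I) (B i).1) *: \prod_(i in ~: I) lin B i.
  pose P := \sum_(m <- msupp G) G@_m *: \prod_k U (idx_set k) ^+ m k.
  have PE u : P.[u] = G.@[fun k => (U (idx_set k)).[u]].
    rewrite mevalE horner_sum; apply: eq_bigr => m _.
    rewrite hornerZ horner_prod; congr (_ * _); apply: eq_bigr => k _.
    by rewrite horner_exp.
  have UE u I : (U I).[u] =
      a * c1 * \prod_(i in I) (A i).1 * \prod_(i in ~: I) (u + (A i).2) +
      b * c2 * \prod_(i in I) (B i).1 * \prod_(i in ~: I) (u + (B i).2).
    rewrite hornerD !hornerZ !horner_prod.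
    by congr (_ * _ + _ * _); apply: eq_bigr => i _; rewrite !hornerE.
  suff P0 : P = 0.
    transitivity P.[0]; last by rewrite P0 horner0.
    rewrite PE; apply: meval_eq => k; rewrite UE !mxE !mulrA.
    by congr (_ * _ + _ * _); apply: eq_bigr => i _; rewrite add0r.
  (* Away from the roots of [h], all the perturbed second coordinates are nonzero and can be divided
     out. *)
  pose h := \prod_i lin A i * \prod_i lin B i.
  have hn0 : h != 0.
    rewrite mulf_neq0 //; apply/prodf_neq0 => i _;
    by rewrite -size_poly_eq0 size_XaddC.
  suff /eqP : P * h = 0 by rewrite mulf_eq0 (negPf hn0) orbF => /eqP.
  apply: poly_eq0_everywhere => u; rewrite hornerM.
  have [hu|] := eqVneq h.[u] 0; first by rewrite hu mulr0.
  rewrite hornerM !horner_prod mulf_eq0 negb_or => /andP[/prodf_neq0 Au /prodf_neq0 Bu].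
  have {}Au i : u + (A i).2 != 0 by have := Au i isT; rewrite !hornerE.
  have {}Bu i : u + (B i).2 != 0 by have := Bu i isT; rewrite !hornerE.
  rewrite PE (GE (fun I => (U I).[u])); case: eqP => [_|/eqP U0]; first exact: mul0r.
  (* Dividing by the coordinate at [set0] turns the coefficients on the secant line into weights of
     sum 1. *)
  pose al := a * c1 * \prod_i (u + (A i).2) / (U set0).[u].
  pose be := b * c2 * \prod_i (u + (B i).2) / (U set0).[u].
  have ab1 : al + be = 1.
    rewrite /al /be -mulrDl; apply: (canLR (mulfK U0)); rewrite mul1r UE.
    rewrite !big_set0 !mulr1 setC0.
    by congr (_ * _ + _ * _); apply: eq_bigl => i; rewrite inE.
  have -> : g.@[fun k => (U (idx_set k)).[u] / (U set0).[u]] =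
      g.@[two_point al be (fun i => (A i).1 / (u + (A i).2))
            (fun i => (B i).1 / (u + (B i).2)) 0].
    apply: meval_eq => k; rewrite mxE UE -!(mulrA (_ * _)) !prod_divr_setC //.
    by rewrite /al /be; ring.
  by rewrite g0 ?mulr0 ?mul0r.
have := xcl d G Ghom G0.
have -> : G.@[(\row_k Defs.coord x (idx_set k)) 0] =
    G.@[fun k => Defs.coord x (idx_set k)].
  by apply: meval_eq => k; rewrite mxE.
rewrite (GE (Defs.coord x)) coord_small ?cards0 // oner_eq0 expr1n mul1r => <-.
by apply: meval_eq => k; rewrite divr1 coord_idx.
Qed.

(** The point lies on the line through the Segre points of [p] and [q]. Proportionality of these
    would have factor 1 by the coordinate at [set0], contradicting [p i != q i]. *)
Lemma two_point_secant (K : fieldType) (n : nat) (a b : K) (p q : 'I_n -> K) i :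
  a + b = 1 -> p i != q i -> secant_chart (two_point a b p q).
Proof.
move=> ab1 pqi.
have segreP (f : 'I_n -> K) : segre (segre_map (fun i => (f i, 1))).
  exists (fun i => (f i, 1)); split; last by exists 1; rewrite ?oner_eq0 ?scale1r.
  by move=> j; rewrite xpair_eqE oner_eq0 andbF.
have segreE (f : 'I_n -> K) k : segre_map (fun i => (f i, 1)) 0 k =
    \prod_(i in idx_set k) f i.
  by rewrite mxE /= [X in _ * X]big1 ?mulr1.
rewrite /secant_chart; set X := (\row_k _ : 'rV_#|idx n 0|).
have XE : X = a *: segre_map (fun i => (p i, 1)) + b *: segre_map (fun i => (q i, 1)).
  by apply/rowP => k; rewrite [LHS]mxE coord_two_point // [RHS]mxE; congr (_ + _);
    rewrite [RHS]mxE segreE.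
have Xn0 : X != 0.
  have [k k0] := idx_setP (leq0n #|set0 : {set 'I_n}|).
  apply/eqP => /rowP/(_ k); rewrite !mxE k0 coord_small ?cards0 // => /eqP.
  by rewrite oner_eq0.
split=> // d f _; apply.
exists (segre_map (fun i => (p i, 1))), (segre_map (fun i => (q i, 1))).
split=> //; last by split=> //; exists a, b.
move=> [c _ /rowP qcp].
have [k k0] := idx_setP (leq0n #|set0 : {set 'I_n}|).
have := qcp k; rewrite [RHS]mxE !segreE k0 !big_set0 mulr1 => c1.
have [l li] := idx_setP (leq0n #|[set i]|).
have := qcp l; rewrite [RHS]mxE !segreE li !big_set1 -c1 mul1r => qp.
by rewrite qp eqxx in pqi.
Qed.

(** * The ideals of the two varieties *)

Lemma vanishing_zariski_closure (K : fieldType) (N : nat) (X : 'rV[K]_N -> Prop) f :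
  vanishing_ideal (zariski_closure X) f <-> vanishing_ideal X f.
Proof. by split=> Xf x Xx; [apply: Xf => g; apply | apply: Xx]. Qed.

Lemma toric_ideal (K : numFieldType) (n : nat) (f : {mpoly K[#|idx n 2|]}) :
  vanishing_ideal (@toric K n) f <-> ideal_span (binomials (@var K n 2)) f.
Proof.
rewrite vanishing_zariski_closure; split=> [f0|fG _ [t0 [t [_ _ ->]]]].
  apply: (@toric_ideal_span K _ _ (fun k => toric_exp (idx_set k)) [:: 0]).
    move=> t tE; have {}tE j : t j != 0 by have := tE j; rewrite inE.
    pose z : 'rV[K]_#|idx n 2| :=
      \row_k (t (inl tt) * \prod_(i in idx_set k) t (inr (inl i))).
    rewrite -(f0 z); last by exists (t (inl tt)), (fun i => t (inr (inl i))).
    by apply: meval_eq => k; rewrite meval_toric_exp // idx_set_ge mxE.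
  by move=> a b; apply: congr_toric_exp.
apply: ideal_span_vanish fG => g.
apply: (binomials_vanish (c := t0) (s := 1) (d := t)) => I I1.
by rewrite meval_var (coord_row (fun I => t0 * \prod_(i in I) t i)) // expr1n mulr1.
Qed.

Lemma secant_ideal (K : numClosedFieldType) (n : nat) (f : {mpoly K[#|idx n 1|]}) :
  (0 < n)%N ->
  secant_ideal_cum f <-> ideal_span (binomials (@var K n 1)) f.
Proof.
move=> n0; have i0 : 'I_n by case: n n0 {f} => // n _; apply: ord0.
have substE (x : 'rV[K]_#|idx n 1|) :
    (cumulant_subst f).@[x 0] = f.@[fun k => (zcum K (idx_set k)).@[x 0]].
  by rewrite /cumulant_subst comp_mpoly_meval; apply: meval_eq => k; rewrite tnth_mktuple.
split=> [f0|fG]; last first.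
  apply: secant_vanish => a b p q ab1; rewrite substE.
  apply: ideal_span_vanish fG => g.
  apply: (binomials_vanish (c := a * b) (s := b - a) (d := fun i => p i - q i)) => I I1.
  rewrite (meval_var_fun (fun I => (zcum K I).@[two_point a b p q 0])) 1?ltnW //.
  exact: meval_zcum.
(* Excluding 0 and -1/4 makes the differences [d i] nonzero and [4 t0 + 1] invertible. *)
apply: (@toric_ideal_span K _ _ (fun k => toric_exp (idx_set k)) [:: 0; - 4%:R^-1]);
  last by move=> a b; apply: congr_toric_exp.
move=> t tE; have {}tE j : t j != 0 /\ 4%:R * t j + 1 != 0.
  have := tE j; rewrite !inE negb_or => /andP[-> tj]; split=> //.
  apply: contraNneq tj => t4; apply/eqP/(mulfI (x := 4%:R)); first by rewrite pnatr_eq0.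
  by rewrite mulrN divff ?pnatr_eq0 //; apply/eqP; rewrite -subr_eq0 opprK t4.
pose t0 := t (inl tt); pose d i := t (inr (inl i)); pose mu i := t (inr (inr i)).
have [_ t4] := tE (inl tt).
(* [s] is to be [b - a]. With [a + b = 1] this gives [a b = (1 - s^2) / 4], and the required
   [a b = t0 s^2] then determines [s^2]. *)
pose s := sqrtC (4%:R * t0 + 1)^-1.
have s2 : s ^+ 2 = (4%:R * t0 + 1)^-1 by rewrite sqrtCK.
have s0 : s != 0 by rewrite sqrtC_eq0 invr_eq0.
have two0 : 2%:R != 0 :> K by rewrite pnatr_eq0.
pose a := (1 - s) / 2%:R; pose b := (1 + s) / 2%:R.
have ab1 : a + b = 1 by rewrite /a /b; field.
have abE : a * b = t0 * s ^+ 2.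
  transitivity ((1 - s ^+ 2) / 4%:R); first by rewrite /a /b; field.
  by rewrite s2; field.
have baE : b - a = s by rewrite /a /b; field.
(* Solves for mean [mu i] and difference [d i / s]. *)
pose p i := mu i + b * (d i / s); pose q i := mu i - a * (d i / s).
have pqE i : p i - q i = d i / s.
  by rewrite /p /q -[RHS]mul1r -ab1; ring.
have muE i : a * p i + b * q i = mu i.
  by rewrite /p /q -[RHS]mul1r -ab1; ring.
have pq0 : p i0 != q i0.
  by rewrite -subr_eq0 pqE mulf_neq0 ?invr_eq0 //; case: (tE (inr (inl i0))).
rewrite -(f0 (two_point a b p q) (two_point_secant ab1 pq0)) substE.
apply: meval_eq => k; rewrite meval_toric_exp //; case: ifPn => [k1|k1].
  (* The factors [s^2] and [s^(#|I| - 2)] together cancel the division by [s] in each of the [#|I|]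
     differences. *)
  rewrite meval_zcum // abE baE -!(mulrA t0); congr (_ * _).
  rewrite -exprD subnKC // -prodr_const -big_split /=.
  by apply: eq_bigr => i _; rewrite pqE mulrC divfK.
have /cards1P[i ->] : #|idx_set k| == 1%N by rewrite eqn_leq leqNgt k1 idx_set_ge.
by rewrite meval_zcum1 // big_set1 muE.
Qed.

Local Open Scope complex_scope.

Theorem corollary4p8 (R : realType) (n : nat) (hn : (2 <= n)%N) :
  (forall f : {mpoly R[i][#|idx n 2|]},
     vanishing_ideal (@toric R[i] n) f
       <-> ideal_span (binomials (@var R[i] n 2)) f)
  /\
  (forall f : {mpoly R[i][#|idx n 1|]},
     secant_ideal_cum f <-> ideal_span (binomials (@var R[i] n 1)) f).
Proof.
split=> f; first exact: toric_ideal.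
by apply: secant_ideal; apply: ltnW.
Qed.
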